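(* Let $(L,\otimes,u)$ be a commutative unital quantale. An $L$-ordered set $(P,e)$ is an algebraic $L$-dcpo if and only if there exists an $L$-closure space $(X,\langle\cdot\rangle)$ such that $(\mathfrak{C}(X),\mathrm{sub})\cong(P,e)$.
   Context: Quantale: $(L,\otimes,u)$ is a complete lattice with bottom $0$ and top $1$, with an associative commutative operation $\otimes$ with unit $u$, distributing over arbitrary joins; $\to$ is its residuation, i.e. $a\otimes b\le c\iff a\le b\to c$. An $L$-subset of $X$ is a map $A:X\to L$; $L^X$ is ordered pointwise. For $x\in X$, $u_x\in L^X$ is given by $u_x(x)=u$ and $u_x(y)=0$ for $y\ne x$. $\mathrm{sub}(A,B)=\bigwedge_{x\in X}(A(x)\to B(x))$ for $A,B\in L^X$. $L$-orders: an $L$-ordered set is a set $P$ with $e:P\times P\to L$ such that $e(x,x)\ge u$; $e(x,y)\otimes e(y,z)\le e(x,z)$; and $e(x,y)\wedge e(y,x)\ge u$ implies $x=y$. Any subset of $L^X$ is an $L$-ordered set under $\mathrm{sub}$. $P\cong Q$ means there is a bijection $f:P\to Q$ with $e_P(x,y)=e_Q(f(x),f(y))$ for all $x,y$. An element $x_0$ is the supremum $\sqcup A$ of $A\in L^P$ if $e(x_0,y)=\bigwedge_{x\in P}(A(x)\to e(x,y))$ for all $y\in P$. $D\in L^P$ is directed if $\bigvee_{x\in P}D(x)\ge u$ and $D(x)\otimes D(y)\le\bigvee_{z\in P}D(z)\otimes e(x,z)\otimes e(y,z)$ for all $x,y$. $D\in L^P$ is a lower set if $D(x)\otimes e(y,x)\le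 D(y)$ for all $x,y$; an ideal is a directed lower set; $\mathcal{I}_L(P)$ is the set of ideals. $P$ is an $L$-dcpo if every directed $L$-subset has a supremum. For an $L$-dcpo $P$ and $x\in P$, define $\Downarrow x\in L^P$ by $\Downarrow x(y)=\bigwedge_{I\in\mathcal{I}_L(P)}(e(x,\sqcup I)\to I(y))$. An element $x$ of an $L$-dcpo $P$ is compact if $\Downarrow x(x)\ge u$; $K(P)$ is the set of compact elements. Define $k(x)\in L^P$ by $k(x)(y)=e(y,x)$ for $y\in K(P)$ and $k(x)(y)=0$ otherwise. $P$ is an algebraic $L$-dcpo if it is an $L$-dcpo and for every $x\in P$, $k(x)$ is directed and $\sqcup k(x)=x$. Closure spaces: an $L$-closure space $(X,\langle\cdot\rangle)$ is a set $X$ with $\langle\cdot\rangle:L^X\to L^X$ such that for all $A,B\in L^X$: $A\le\langle A\rangle$; $\mathrm{sub}(A,B)\le\mathrm{sub}(\langle A\rangle,\langle B\rangle)$; $\langle\langle A\rangle\rangle=\langle A\rangle$. A directed closed set of $(X,\langle\cdot\rangle)$ is $U\in L^X$ such that for all $x,y\in X$: (DC1) $\bigvee_{x\in X}U(x)\ge u$; (DC2) $U(x)\le\mathrm{sub}(\langle u_x\rangle,U)$; (DC3) $U(x)\le\bigvee_{y\in X}U(y)\otimes\langle u_y\rangle(x)$; (DC4) $U(x)\otimes U(y)\le\bigvee_{z\in X}U(z)\otimes\langle u_z\rangle(x)\otimes\langle u_z\rangle(y)$. $\mathfrak{C}(X)$ is the set of all directed closed sets. *)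

(* Defs.v *)
From HB Require Import structures.
From mathcomp Require Import all_boot all_order.
From mathcomp Require Import boolp classical_sets.

Set Implicit Arguments.
Unset Strict Implicit.
Unset Printing Implicit Defensive.

Import Order.TTheory.

Local Open Scope classical_set_scope.
Local Open Scope order_scope.

Declare Scope quantale_scope.
Delimit Scope quantale_scope with Q.
Local Open Scope quantale_scope.

Reserved Notation "a ⊗ b" (at level 40, left associativity).
Reserved Notation "a ⇝ b" (at level 55, right associativity).
Reserved Notation "\bigvee_ x F" (at level 41, x binder, F at level 41,
  format "\bigvee_ x  F").
Reserved Notation "\bigwedge_ x F" (at level 41, x binder, F at level 41,
  format "\bigwedge_ x  F").

(* [supremum \bot] also returns [\bot] on the empty set, so under
   [has_supremums] it is the join of every subset, including [set0]. *)
HB.mixin Record isQuantale d L of Order.TBLattice d L := {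
  has_supremums : forall A : set L, supremums A !=set0;
  qmul : L -> L -> L;
  qunit : L;
  qmulA : associative qmul;
  qmulC : commutative qmul;
  qmul1q : left_id qunit qmul;
  qmul_supr : forall (a : L) (B : set L),
    qmul a (supremum \bot B) = supremum \bot [set qmul a b | b in B];
}.

#[short(type="quantaleType")]
HB.structure Definition Quantale d :=
  { L of isQuantale d L & Order.TBLattice d L }.

Arguments qunit {d L} : rename.

Notation "a ⊗ b" := (qmul a b) : quantale_scope.
Notation "\bigvee_ x F" := (supremum \bot (range (fun x => F)))
  : quantale_scope.
Notation "\bigwedge_ x F" := (infimum \top (range (fun x => F)))
  : quantale_scope.

Definition qres d (L : quantaleType d) (a b : L) : L :=
  supremum \bot [set c | a ⊗ c <= b].

Notation "a ⇝ b" := (qres a b) : quantale_scope.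

Section QuantaleTheory.
Context d (L : quantaleType d).
Implicit Types (a b c : L) (A B : set L).

Lemma supremum_supremums A : supremums A (supremum \bot A).
Proof.
rewrite /supremum; case: ifPn => [/eqP -> | _].
  by split=> [x []|x _]; rewrite le0x.
by case: xgetP => // /(_ _) n; have [s /n] := has_supremums A.
Qed.

Lemma supremum_leP A b : supremum \bot A <= b <-> ubound A b.
Proof.
have [ubs lubs] := supremum_supremums A; split=> [sb x Ax|/lubs//].
exact: le_trans (ubs x Ax) sb.
Qed.

Lemma infimum_infimums A : infimums A (infimum \top A).
Proof.
rewrite /infimum; case: ifPn => [/eqP -> | _].
  by split=> [x []|x _]; rewrite lex1.
case: xgetP => // n; have [s [ubs lubs]] := has_supremums (lbound A).
case: (n s); split=> // x Ax; apply: lubs => y; exact.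
Qed.

Lemma le_infimumP A b : b <= infimum \top A <-> lbound A b.
Proof.
have [lbi glbi] := infimum_infimums A; split=> [bi x Ax|/glbi//].
exact: le_trans bi (lbi x Ax).
Qed.

Lemma qmul_le2l a b c : b <= c -> a ⊗ b <= a ⊗ c.
Proof.
move=> bc; have -> : c = supremum \bot [set b; c].
  apply/le_anti/andP; split; last by apply/supremum_leP => x [] ->.
  by have /supremum_leP := lexx (supremum \bot [set b; c]); apply; right.
rewrite qmul_supr.
have /supremum_leP := lexx (supremum \bot [set a ⊗ x | x in [set b; c]]).
by apply; exists b => //; left.
Qed.

Lemma qresP a b c : a ⊗ b <= c <-> a <= (b ⇝ c).
Proof.
split=> [abc|abc].
  have /supremum_leP := lexx (b ⇝ c).
  by apply; rewrite /= qmulC.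
rewrite qmulC; apply: le_trans (qmul_le2l b abc) _.
by rewrite qmul_supr; apply/supremum_leP => _ [x bxc <-].
Qed.

End QuantaleTheory.

Section LSubset.
Context d (L : quantaleType d) (X : Type).
Implicit Types (A B : X -> L) (x y : X).

Definition Lsub A B : L := \bigwedge_x (A x ⇝ B x).

Definition Lpoint x : X -> L := fun y => if `[< y = x >] then qunit else \bot.

End LSubset.

Section LOrder.
Context d (L : quantaleType d) (P : Type) (e : P -> P -> L).
Implicit Types (A D I : P -> L) (x y z : P).

Record is_Lorder : Prop := IsLorder {
  Lorder_refl : forall x, qunit <= e x x;
  Lorder_trans : forall x y z, e x y ⊗ e y z <= e x z;
  Lorder_anti : forall x y, qunit <= e x y `&` e y x -> x = y;
}.

Definition is_Lsup A x0 : Prop :=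
  forall y, e x0 y = \bigwedge_x (A x ⇝ e x y).

Definition Ldirected D : Prop :=
  qunit <= \bigvee_x D x /\
  forall x y, D x ⊗ D y <= \bigvee_z (D z ⊗ e x z ⊗ e y z).

Definition Llower D : Prop := forall x y, D x ⊗ e y x <= D y.

Definition Lideal I : Prop := Ldirected I /\ Llower I.

Definition Ldcpo : Prop := forall D, Ldirected D -> exists x0, is_Lsup D x0.

(* The meet runs over the pairs of an ideal [p.1] and its supremum [p.2];
   in an L-dcpo each ideal occurs in exactly one such pair. *)
Definition Lwaybelow x : P -> L := fun y =>
  infimum \top [set e x p.2 ⇝ p.1 y
               | p in [set p : (P -> L) * P | Lideal p.1 /\ is_Lsup p.1 p.2]].

Definition Lcompact : set P := [set x | qunit <= Lwaybelow x x].

Definition Lcompact_below x : P -> L :=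
  fun y => if `[< Lcompact y >] then e y x else \bot.

Definition Lalgebraic : Prop :=
  Ldcpo /\
  forall x, Ldirected (Lcompact_below x) /\ is_Lsup (Lcompact_below x) x.

End LOrder.

Definition Lisomorphic d (L : quantaleType d) (P Q : Type)
    (eP : P -> P -> L) (eQ : Q -> Q -> L) : Prop :=
  exists f : P -> Q, bijective f /\ forall x y, eP x y = eQ (f x) (f y).

Section LClosure.
Context d (L : quantaleType d) (X : Type) (cl : (X -> L) -> (X -> L)).

Record is_Lclosure : Prop := IsLclosure {
  Lclosure_ext : forall A x, A x <= cl A x;
  Lclosure_sub : forall A B, Lsub A B <= Lsub (cl A) (cl B);
  Lclosure_idem : forall A, cl (cl A) = cl A;
}.

Record directed_closed (U : X -> L) : Prop := DirectedClosed {
  dclosed_DC1 : qunit <= \bigvee_x U x;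
  dclosed_DC2 : forall x, U x <= Lsub (cl (Lpoint L x)) U;
  dclosed_DC3 : forall x, U x <= \bigvee_y (U y ⊗ cl (Lpoint L y) x);
  dclosed_DC4 : forall x y, U x ⊗ U y <=
    \bigvee_z (U z ⊗ cl (Lpoint L z) x ⊗ cl (Lpoint L z) y);
}.

Definition directed_closed_sets : set (X -> L) := [set U | directed_closed U].

End LClosure.

Definition Lsub_on d (L : quantaleType d) (X : Type) (C : set (X -> L))
    (U V : C) : L :=
  Lsub (val U) (val V).

(* Main.v *)
Require Import Defs.
From mathcomp Require Import all_boot all_order.
From mathcomp Require Import boolp classical_sets.

(** Write [r x y := cl (Lpoint L y) x].  Since [Lsub (Lpoint L x) A] is just
    [A x], the axioms of a closure operator make [r] an L-preorder on [X], and
    a directed closed set of [X] is exactly an ideal of [(X, r)]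
    ([directed_closedE]).  Conversely every L-preorder [r] on a set arises in
    this way, from the operator closing an L-subset downwards
    ([Ldown_closure], [Ldown_point]).  So the theorem says that algebraic
    L-dcpos are the ideal completions of L-preordered sets.  An isomorphism of
    [P] with such a completion is handled as a map [G] sending each point of
    [P] to an ideal ([ideal_representation]).

    If [P] is algebraic, take for [X] the compact elements of [P] with the
    order of [P], and let [G p] be [k p].  Algebraicity says that [k p] is an
    ideal with supremum [p], which gives the embedding.  An ideal [U] of
    compact elements generates an ideal of [P], whose supremum [s] satisfies
    [k s = U]: for a compact [x], [e x s] is at most the degree of [x] in that
    generated ideal, and this is at most [U x] because [U] is a lower set
    ([algebraic_representation]).

    Conversely, let [P] be represented by the ideals of [(X, r)].  A directed
    union of ideals is an ideal, so directed suprema exist and are computed as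
    unions.  The principal ideal of [x] is [G (phi x)] for some [phi x] in [P],
    and the Yoneda identity [e (phi x) p = G p x] together with the formula for
    directed suprema makes [phi x] compact.  Every [p] is the supremum of the
    ideal of [P] generated by the [phi x] weighted with [G p x].  The
    compact elements of [P] need not be of the form [phi x], but a compact [q]
    satisfies [e q p <= \bigvee_x (G p x ⊗ e q (phi x))], which is enough to
    transfer directedness from [G p] to [k p]
    ([representation_algebraic]). *)

Set Implicit Arguments.
Unset Strict Implicit.
Unset Printing Implicit Defensive.

Import Order.TTheory.

Local Open Scope classical_set_scope.
Local Open Scope order_scope.
Local Open Scope quantale_scope.

(** * Calculus in a commutative unital quantale *)

Section Calculus.
Context d (L : quantaleType d).
Implicit Types (a b c : L).

Lemma qmulq1 a : a ⊗ qunit = a.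
Proof. by rewrite qmulC qmul1q. Qed.

Lemma qmulACA (a b a' b' : L) : a ⊗ b ⊗ (a' ⊗ b') = a ⊗ a' ⊗ (b ⊗ b').
Proof. by rewrite -!qmulA [b ⊗ (_ ⊗ _)]qmulA [b ⊗ a']qmulC -qmulA. Qed.

Lemma qmul_le a b a' b' : a <= a' -> b <= b' -> a ⊗ b <= a' ⊗ b'.
Proof.
move=> aa' bb'; apply: le_trans (qmul_le2l a bb') _.
by rewrite qmulC [a' ⊗ _]qmulC; apply: qmul_le2l.
Qed.

Lemma qmul_ge_unit a b : qunit <= b -> a <= a ⊗ b.
Proof. by move=> ub; rewrite -{1}[a]qmulq1; apply: qmul_le2l. Qed.

Lemma qmul_leP a b c : a <= (b ⇝ c) <-> a ⊗ b <= c.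
Proof. by split=> /qresP. Qed.

Lemma bigvee_leP I (F : I -> L) b : \bigvee_i F i <= b <-> forall i, F i <= b.
Proof.
rewrite supremum_leP; split=> [h i|h _ [i _ <-]//].
by apply: h; exists i.
Qed.

Lemma bigvee_ge I (F : I -> L) i : F i <= \bigvee_j F j.
Proof. by move: i; apply/bigvee_leP. Qed.

Lemma bigvee_sup I (F : I -> L) i a : a <= F i -> a <= \bigvee_j F j.
Proof. by move=> aF; apply: le_trans aF (bigvee_ge F i). Qed.

Lemma bigwedge_geP I (F : I -> L) b :
  b <= \bigwedge_i F i <-> forall i, b <= F i.
Proof.
rewrite le_infimumP; split=> [h i|h _ [i _ <-]//].
by apply: h; exists i.
Qed.

Lemma qmul_bigveer I (F : I -> L) a :
  a ⊗ (\bigvee_i F i) = \bigvee_i (a ⊗ F i).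
Proof. by rewrite qmul_supr image_comp. Qed.

Lemma qmul_bigveel I (F : I -> L) a :
  (\bigvee_i F i) ⊗ a = \bigvee_i (F i ⊗ a).
Proof.
rewrite qmulC qmul_bigveer.
by have -> : (fun i => F i ⊗ a) = (fun i => a ⊗ F i)
  by apply/funext => i; rewrite qmulC.
Qed.

Lemma qmul0q a : \bot ⊗ a = \bot.
Proof.
apply/le_anti; rewrite le0x andbT.
by apply/qmul_leP; apply: le0x.
Qed.

(** The indirect form of equality, used to compare meets and residuations
    through their universal properties. *)
Lemma eq_leP a b : (forall c, c <= a <-> c <= b) -> a = b.
Proof.
move=> h; apply/le_anti/andP; split; first exact/h.
exact/h.
Qed.

Lemma le_LsubP X (A B : X -> L) a :
  a <= Lsub A B <-> forall x, a ⊗ A x <= B x.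
Proof.
by rewrite bigwedge_geP; split=> h x; apply/qmul_leP; apply: h.
Qed.

Lemma Lsub_point X (x : X) (A : X -> L) : Lsub (Lpoint L x) A = A x.
Proof.
apply: eq_leP => a; rewrite le_LsubP /Lpoint; split=> [/(_ x)|ax y].
  by case: asboolP => // _; rewrite qmulq1.
by case: asboolP => [->|_]; rewrite ?qmulq1 // qmulC qmul0q le0x.
Qed.

End Calculus.

Arguments bigvee_sup {d L I F} i {a}.

(** * Ideals of L-preordered sets *)

Definition is_Lpreorder d (L : quantaleType d) X (r : X -> X -> L) : Prop :=
  (forall x, qunit <= r x x) /\ forall x y z, r x y ⊗ r y z <= r x z.

Lemma Lorder_preorder d (L : quantaleType d) P (e : P -> P -> L) :
  is_Lorder e -> is_Lpreorder e.
Proof. by case. Qed.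

Section Preorder.
Context d (L : quantaleType d) P (e : P -> P -> L) (e_pre : is_Lpreorder e).
Implicit Types (A D I : P -> L) (s : P).

Let e_refl x : qunit <= e x x. Proof. exact: e_pre.1. Qed.
Let e_trans x y z : e x y ⊗ e y z <= e x z. Proof. exact: e_pre.2. Qed.

Lemma is_LsupP A s :
  is_Lsup e A s <->
  forall y a, a <= e s y <-> forall x, a ⊗ A x <= e x y.
Proof.
split=> [sup y a|h y].
  rewrite sup bigwedge_geP.
  by split=> h x; apply/qmul_leP; apply: h.
apply: eq_leP => a; rewrite h bigwedge_geP.
by split=> h' x; apply/qmul_leP; apply: h'.
Qed.

Lemma Lsup_ubound A s x : is_Lsup e A s -> A x <= e x s.
Proof.
move/is_LsupP/(_ s qunit) => [/(_ (e_refl s))/(_ x) + _].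
by rewrite qmul1q.
Qed.

Lemma LcompactP x :
  Lcompact e x <->
  forall I s, Lideal e I -> is_Lsup e I s -> e x s <= I x.
Proof.
rewrite /Lcompact /= /Lwaybelow le_infimumP; split=> [h I s Ii Is|].
  rewrite -[e x s]qmul1q; apply/qmul_leP/h.
  by exists (I, s).
by move=> h _ [[I s] /= [Ii Is] <-]; apply/qmul_leP; rewrite qmul1q; apply: h.
Qed.

Lemma principal_ideal x : Lideal e (e^~ x).
Proof.
split; last by move=> y z; rewrite qmulC; apply: e_trans.
split; first exact: (bigvee_sup x (e_refl x)).
move=> y z; apply: (bigvee_sup x).
by rewrite -qmulA [leRHS]qmulC; apply: qmul_ge_unit.
Qed.

Section GeneratedIdeal.
Context X (r : X -> X -> L) (phi : X -> P).
Implicit Types (U : X -> L) (p q : P) (x y : X).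
Hypothesis phi_mono : forall x y, r x y <= e (phi x) (phi y).

(** The lower set of [P] generated by the image of [U] under [phi]. *)
Definition Lgenerated U : P -> L := fun p => \bigvee_x (U x ⊗ e p (phi x)).

(** Upper bounds that exist in [X] can be taken along [phi]: this is what
    directedness of [U] gives about the points of [P]. *)
Lemma directed_along U p q : Ldirected r U ->
  Lgenerated U p ⊗ Lgenerated U q <=
  \bigvee_z (U z ⊗ e p (phi z) ⊗ e q (phi z)).
Proof.
move=> [_ Udir]; rewrite qmul_bigveel; apply/bigvee_leP => x.
rewrite qmul_bigveer; apply/bigvee_leP => y; rewrite qmulACA.
apply: le_trans (qmul_le (Udir x y) (lexx _)) _.
rewrite qmul_bigveel; apply/bigvee_leP => z; apply: (bigvee_sup z).
rewrite -!qmulA qmul_le2l // qmulA qmulACA.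
rewrite [r x z ⊗ _]qmulC [r y z ⊗ _]qmulC.
by apply: qmul_le; apply: le_trans (e_trans _ _ _); apply: qmul_le2l.
Qed.

Lemma generated_ideal U : Ldirected r U -> Lideal e (Lgenerated U).
Proof.
move=> Udir; have geU z : U z <= Lgenerated U (phi z).
  by apply: (bigvee_sup z); apply: qmul_ge_unit.
split; first split.
- apply: le_trans Udir.1 _; apply/bigvee_leP => x.
  exact: (bigvee_sup (phi x) (geU x)).
- move=> p q; apply: le_trans (directed_along p q Udir) _.
  apply/bigvee_leP => z; apply: (bigvee_sup (phi z)).
  by rewrite -!qmulA; apply: qmul_le.
move=> p q; rewrite qmul_bigveel; apply/bigvee_leP => x.
by apply: (bigvee_sup x); rewrite -qmulA [e p _ ⊗ _]qmulC qmul_le2l.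
Qed.

(** A point lies above the ideal generated by [U] as soon as it lies above
    the [phi x], so suprema can be tested along [phi]. *)
Lemma Lsup_generatedP U s :
  is_Lsup e (Lgenerated U) s <->
  forall p a, a <= e s p <-> forall x, a ⊗ U x <= e (phi x) p.
Proof.
rewrite is_LsupP.
have gen p a : (forall q, a ⊗ Lgenerated U q <= e q p) <->
               (forall x, a ⊗ U x <= e (phi x) p).
  split=> [h x|h q].
    apply: le_trans (h (phi x)); apply: qmul_le2l.
    by apply: (bigvee_sup x); apply: qmul_ge_unit.
  rewrite qmul_bigveer; apply/bigvee_leP => x; rewrite qmulA.
  apply: le_trans (qmul_le (h x) (lexx _)) _.
  by rewrite qmulC; apply: e_trans.
by split=> h p a; rewrite h gen.
Qed.

End GeneratedIdeal.
End Preorder.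

Lemma Lsup_unique d (L : quantaleType d) P (e : P -> P -> L) (A : P -> L) s t :
  is_Lorder e -> is_Lsup e A s -> is_Lsup e A t -> s = t.
Proof.
move=> e_ord As At; have est y : e s y = e t y by rewrite As At.
apply: (Lorder_anti e_ord).
by rewrite lexI est -(est s) !(Lorder_refl e_ord).
Qed.

(** * Directed closed sets as ideals *)

Definition Lspec d (L : quantaleType d) X (cl : (X -> L) -> (X -> L)) x y : L :=
  cl (Lpoint L y) x.

Section Specialization.
Context d (L : quantaleType d) X (cl : (X -> L) -> (X -> L)).
Hypothesis cl_closure : is_Lclosure cl.

Lemma Lspec_preorder : is_Lpreorder (Lspec cl).
Proof.
case: cl_closure => ext sub idem; split=> [x|x y z].
  rewrite /Lspec -(Lsub_point x (cl _)); apply/le_LsubP => y.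
  by rewrite qmul1q; apply: ext.
have /le_LsubP/(_ x) : Lspec cl y z <= Lsub (cl (Lpoint L y)) (cl (Lpoint L z)).
  by rewrite /Lspec -(Lsub_point y (cl _)) -{2}(idem (Lpoint L z)); apply: sub.
by rewrite qmulC.
Qed.

(** DC2 and DC4 say that [U] is a lower set and that it is up-directed; DC3
    holds with [y := x] by reflexivity. *)
Lemma directed_closedE U : directed_closed cl U <-> Lideal (Lspec cl) U.
Proof.
split=> [[DC1 DC2 DC3 DC4]|[[DC1 DC4] low]].
  by split=> // x y; have /le_LsubP := DC2 x; apply.
split=> // x; first by apply/le_LsubP => y; apply: low.
by apply: (bigvee_sup x); apply: qmul_ge_unit; apply: Lspec_preorder.1.
Qed.

End Specialization.

Section DownClosure.
Context d (L : quantaleType d) X (r : X -> X -> L) (r_pre : is_Lpreorder r).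

Lemma Ldown_closure : is_Lclosure (Lgenerated r id).
Proof.
have ext A x : A x <= Lgenerated r id A x.
  by apply: (bigvee_sup x); apply: qmul_ge_unit; apply: r_pre.1.
split=> // [A B|A].
  apply/le_LsubP => x; rewrite qmul_bigveer; apply/bigvee_leP => y.
  apply: (bigvee_sup y); rewrite qmulA qmul_le //.
  by have /le_LsubP := lexx (Lsub A B); apply.
apply/funext => x; apply/le_anti; rewrite ext andbT.
apply/bigvee_leP => y; rewrite qmul_bigveel; apply/bigvee_leP => z.
apply: (bigvee_sup z); rewrite -qmulA; apply: qmul_le2l.
by rewrite qmulC; apply: r_pre.2.
Qed.

Lemma Ldown_point : Lspec (Lgenerated r id) = r.
Proof.
apply/funext => x; apply/funext => y; apply/le_anti/andP; split.
  apply/bigvee_leP => z; rewrite /Lpoint.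
  by case: asboolP => [->|_]; rewrite ?qmul1q // qmul0q le0x.
apply: (bigvee_sup y); rewrite /Lpoint.
by case: asboolP => // _; rewrite qmul1q.
Qed.

End DownClosure.

(** * Representing an L-ordered set by ideals *)

(** An isomorphism from [P] to the ideals of [(X, r)], ordered by inclusion;
    injectivity of [G] follows from [repr_sub] and antisymmetry. *)
Record ideal_representation d (L : quantaleType d) P (e : P -> P -> L)
    X (r : X -> X -> L) (G : P -> X -> L) : Prop := IdealRepresentation {
  repr_sub : forall p q, e p q = Lsub (G p) (G q);
  repr_ideal : forall p, Lideal r (G p);
  repr_surj : forall U, Lideal r U -> exists p, G p = U;
}.

Lemma Lisomorphic_representation d (L : quantaleType d) P (e : P -> P -> L)
    X (cl : (X -> L) -> (X -> L)) :
  is_Lorder e -> is_Lclosure cl ->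
  Lisomorphic (Lsub_on (C := directed_closed_sets cl)) e <->
  exists G, ideal_representation e (Lspec cl) G.
Proof.
move=> e_ord cl_closure; split=> [[f [[g fK gK] fe]]|[G [Gsub Gid Gsurj]]].
  exists (fun p => val (g p)); split=> [p q|p|U Ui].
  - by rewrite -{1}[p]gK -{1}[q]gK -fe.
  - exact/directed_closedE/set_mem/(valP (g p)).
  have Udc : U \in directed_closed_sets cl by apply/mem_set/directed_closedE.
  by exists (f (exist _ U Udc)); rewrite fK.
have surjP (U : directed_closed_sets cl) : exists p, G p = val U.
  by apply: Gsurj; apply/directed_closedE => //; apply/set_mem/(valP U).
pose f U := projT1 (cid (surjP U)).
have fE U : G (f U) = val U by rewrite /f; case: cid.
have Gdc p : G p \in directed_closed_sets cl by apply/mem_set/directed_closedE.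
exists f; split; last by move=> U V; rewrite Gsub !fE.
exists (fun p => exist _ (G p) (Gdc p)) => [U|p]; first exact/val_inj/fE.
have Gfp : G (f (exist _ (G p) (Gdc p))) = G p by rewrite fE.
apply: (Lorder_anti e_ord); rewrite lexI !Gsub Gfp -Gsub.
by rewrite !(Lorder_refl e_ord).
Qed.

(** * Algebraic L-dcpos are ideal completions *)

Section AlgebraicRepresentation.
Context d (L : quantaleType d) P (e : P -> P -> L) (e_ord : is_Lorder e).

Let e_pre := Lorder_preorder e_ord.

Definition compact_rel : Lcompact e -> Lcompact e -> L :=
  fun x y => e (val x) (val y).

Lemma compact_rel_preorder : is_Lpreorder compact_rel.
Proof. by split=> [x|x y z]; [apply: e_pre.1|apply: e_pre.2]. Qed.

Lemma compact_belowE p (x : Lcompact e) :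
  Lcompact_below e p (val x) = e (val x) p.
Proof.
by rewrite /Lcompact_below; case: asboolP => // -[]; apply/set_mem/(valP x).
Qed.

(** Off the compact elements [k p] vanishes, so statements about products
    with [k p] need only be checked on [K(P)]. *)
Lemma compact_below_le p x a b :
  (forall y : Lcompact e, x = val y -> e (val y) p ⊗ a <= b) ->
  Lcompact_below e p x ⊗ a <= b.
Proof.
rewrite /Lcompact_below; case: asboolP => [xc h|_ _]; last by rewrite qmul0q le0x.
exact: (h (exist _ x (mem_set xc))).
Qed.

Lemma algebraic_representation :
  Lalgebraic e ->
  ideal_representation e compact_rel (fun p x => e (val x) p).
Proof.
move=> [dcpo alg]; split=> [p q|p|U Ui].
- have [_ /is_LsupP sup] := alg p.
  apply: eq_leP => a; rewrite sup le_LsubP; split=> h x.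
    by rewrite -compact_belowE.
  by rewrite qmulC; apply: compact_below_le => y ->; rewrite qmulC.
- split; last by move=> x y; rewrite qmulC; apply: e_pre.2.
  have [[nonempty dir] _] := alg p; split.
    apply: le_trans nonempty _; apply/bigvee_leP => x.
    rewrite -[Lcompact_below _ _ _]qmulq1; apply: compact_below_le => y _.
    by rewrite qmulq1; apply: (bigvee_sup y).
  move=> x y; rewrite -!compact_belowE; apply: le_trans (dir _ _) _.
  apply/bigvee_leP => z; rewrite -qmulA; apply: compact_below_le => w ->.
  by apply: (bigvee_sup w); rewrite qmulA.
have val_mono (x y : Lcompact e) : compact_rel x y <= e (val x) (val y) by [].
have Ii := generated_ideal e_pre val_mono Ui.1.
have [s sup] := dcpo _ Ii.1; exists s.
apply/funext => x; apply/le_anti/andP; split.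
  (* The degree of [x] in the ideal generated by [U] is already bounded by
     [U x], as [U] is a lower set of compact elements. *)
  have /LcompactP xc : Lcompact e (val x) by apply/set_mem/(valP x).
  apply: le_trans (xc _ _ Ii sup) _.
  by apply/bigvee_leP => y; apply: Ui.2.
apply: le_trans (Lsup_ubound e_pre (val x) sup).
by apply: (bigvee_sup x); apply: qmul_ge_unit; apply: e_pre.1.
Qed.

End AlgebraicRepresentation.

(** * Ideal completions are algebraic L-dcpos *)

Section RepresentationAlgebraic.
Context d (L : quantaleType d) P (e : P -> P -> L) (e_ord : is_Lorder e).
Context X (r : X -> X -> L) (r_pre : is_Lpreorder r) (G : P -> X -> L).
Hypothesis GP : ideal_representation e r G.
Implicit Types (D : P -> L) (p q s : P) (x y : X).

Let e_pre := Lorder_preorder e_ord.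

Lemma repr_le p q x : e p q ⊗ G p x <= G q x.
Proof. by move: x; apply/le_LsubP; rewrite (repr_sub GP). Qed.

Definition repr_union D : X -> L := fun x => \bigvee_p (D p ⊗ G p x).

Lemma union_ideal D : Ldirected e D -> Lideal r (repr_union D).
Proof.
move=> [nonempty dir]; split; first split.
- apply: le_trans nonempty _; apply/bigvee_leP => p.
  have [[Gp _] _] := repr_ideal GP p.
  apply: le_trans (qmul_ge_unit _ Gp) _; rewrite qmul_bigveer.
  apply/bigvee_leP => x; apply: (bigvee_sup x).
  exact: (bigvee_sup p (lexx _)).
- move=> x y; rewrite qmul_bigveel; apply/bigvee_leP => p.
  rewrite qmul_bigveer; apply/bigvee_leP => q; rewrite qmulACA.
  apply: le_trans (qmul_le (dir p q) (lexx _)) _.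
  rewrite qmul_bigveel; apply/bigvee_leP => s.
  (* Both [x] and [y] lie in the ideal [G s], where they have a common upper
     bound. *)
  have {}dir : D s ⊗ e p s ⊗ e q s ⊗ (G p x ⊗ G q y) <= D s ⊗ (G s x ⊗ G s y).
    rewrite -!qmulA qmul_le2l // qmulA qmulACA.
    by apply: qmul_le; apply: repr_le.
  apply: le_trans dir _; have [[_ Gs] _] := repr_ideal GP s.
  apply: le_trans (qmul_le2l _ (Gs x y)) _.
  rewrite qmul_bigveer; apply/bigvee_leP => z; apply: (bigvee_sup z).
  rewrite !qmulA; apply: qmul_le => //; apply: qmul_le => //.
  exact: (bigvee_sup s (lexx _)).
move=> x y; rewrite qmul_bigveel; apply/bigvee_leP => p.
by apply: (bigvee_sup p); rewrite -qmulA qmul_le2l //; apply: (repr_ideal GP p).2.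
Qed.

Lemma union_sup D s : G s = repr_union D -> is_Lsup e D s.
Proof.
move=> Gs; apply/is_LsupP => q a; rewrite (repr_sub GP) le_LsubP Gs.
split=> [h p|h x].
  rewrite (repr_sub GP) le_LsubP => x; apply: le_trans (h x).
  by rewrite -qmulA qmul_le2l //; apply: (bigvee_sup p).
rewrite qmul_bigveer; apply/bigvee_leP => p; rewrite qmulA.
exact: le_trans (qmul_le (h p) (lexx _)) (repr_le _ _ _).
Qed.

Lemma sup_union D s : Ldirected e D -> is_Lsup e D s -> G s = repr_union D.
Proof.
move=> /union_ideal /(repr_surj GP) [t Gt] sup.
by rewrite (Lsup_unique e_ord sup (union_sup Gt)).
Qed.

Lemma representation_dcpo : Ldcpo e.
Proof.
move=> D /union_ideal /(repr_surj GP) [s Gs].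
by exists s; apply: union_sup.
Qed.

Lemma repr_principal_exists : exists phi, forall x, G (phi x) = r^~ x.
Proof.
have ex x : exists p, G p = r^~ x by apply/(repr_surj GP)/principal_ideal.
by have [phi phiE] := choice ex; exists phi.
Qed.

Section Principal.
Context (phi : X -> P) (phiE : forall x, G (phi x) = r^~ x).

Lemma repr_yoneda x p : e (phi x) p = G p x.
Proof.
apply: eq_leP => a; rewrite (repr_sub GP) le_LsubP phiE; split=> [h|h y].
  exact: le_trans (qmul_ge_unit a (r_pre.1 x)) (h x).
apply: le_trans (qmul_le h (lexx _)) _.
exact: (repr_ideal GP p).2.
Qed.

Lemma principal_mono x y : r x y <= e (phi x) (phi y).
Proof. by rewrite repr_yoneda phiE. Qed.

(** If [phi x] lies below the supremum of an ideal [I], then [x] lies in the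
    union of the [G q], [q] in [I], that is, [phi x] lies below such a [q]. *)
Lemma principal_compact x : Lcompact e (phi x).
Proof.
apply/LcompactP => I s [Idir Ilow] sup.
rewrite repr_yoneda (sup_union Idir sup); apply/bigvee_leP => q.
by rewrite -repr_yoneda; apply: Ilow.
Qed.

Lemma compact_below_principal p x : Lcompact_below e p (phi x) = G p x.
Proof.
rewrite /Lcompact_below -repr_yoneda.
by case: asboolP => // -[]; apply: principal_compact.
Qed.

Lemma repr_generated_sup p : is_Lsup e (Lgenerated e phi (G p)) p.
Proof.
apply/Lsup_generatedP => // q a; rewrite (repr_sub GP) le_LsubP.
by split=> h x; have := h x; rewrite repr_yoneda.
Qed.

(** A compact element below [p] factors, in degree, through the principal
    elements below [p], as these generate an ideal with supremum [p]. *)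
Lemma compact_below_generated p q :
  Lcompact_below e p q <= Lgenerated e phi (G p) q.
Proof.
rewrite /Lcompact_below; case: asboolP => [/LcompactP qc|_]; last exact: le0x.
apply: (qc _ _ _ (repr_generated_sup p)).
exact (generated_ideal e_pre principal_mono (repr_ideal GP p).1).
Qed.

Lemma compact_below_directed p : Ldirected e (Lcompact_below e p).
Proof.
have Gdir := (repr_ideal GP p).1; split.
  apply: le_trans Gdir.1 _; apply/bigvee_leP => x.
  by rewrite -compact_below_principal; apply: bigvee_ge.
move=> q q'.
apply: le_trans (qmul_le (compact_below_generated p q)
                         (compact_below_generated p q')) _.
apply: le_trans (directed_along e_pre principal_mono q q' Gdir) _.
apply/bigvee_leP => z; rewrite -compact_below_principal.
exact: (bigvee_sup (phi z) (lexx _)).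
Qed.

Lemma compact_below_sup p : is_Lsup e (Lcompact_below e p) p.
Proof.
apply/is_LsupP => q a; split=> [h s|h].
  rewrite qmulC; apply: compact_below_le => t ->.
  exact: le_trans (qmul_le2l _ h) (e_pre.2 _ _ _).
rewrite (repr_sub GP) le_LsubP => x.
by rewrite -compact_below_principal -repr_yoneda.
Qed.

End Principal.

Lemma representation_algebraic : Lalgebraic e.
Proof.
split; first exact: representation_dcpo.
have [phi phiE] := repr_principal_exists => p.
by split; [apply: (compact_below_directed phiE)|apply: (compact_below_sup phiE)].
Qed.

End RepresentationAlgebraic.

(** * Algebraic L-dcpos and L-closure spaces *)

Theorem theorem4p7 (d : Order.disp_t) (L : quantaleType d)
    (P : Type) (e : P -> P -> L) (He : is_Lorder e) :
  Lalgebraic e <->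
  exists (X : Type) (cl : (X -> L) -> (X -> L)),
    is_Lclosure cl /\ Lisomorphic (Lsub_on (C := directed_closed_sets cl)) e.
Proof.
split=> [alg|[X [cl [cl_closure]]]].
  have r_pre := compact_rel_preorder He.
  have cl_closure := Ldown_closure r_pre.
  exists (Lcompact e), (Lgenerated (@compact_rel _ _ _ e) id); split=> //.
  apply/Lisomorphic_representation => //; rewrite Ldown_point.
  by eexists; apply: algebraic_representation.
move/(Lisomorphic_representation He cl_closure) => [G GP].
exact: (representation_algebraic He (Lspec_preorder cl_closure) GP).
Qed.
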